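(* Let $k$ and $\Delta\ge2$ be integers, let $\gamma=\frac{1}{2000\Delta^2k^5}$, and suppose $k\ge 12\log_2\Delta+24\log_2k+57$. Then for every $(k,\Delta)$-CNF formula $\Phi$ with variable set $V$ there exists a set $\mathcal M\subseteq V$ with $|V|/6\le|\mathcal M|\le 4|V|/5$ such that $Z^{\mathrm{CNF}}_{\Phi,\mathcal M}(\lambda)\neq0$ for every $\lambda\in\mathbb C$ with $|\lambda-1|\le\gamma$. Furthermore, for this $\mathcal M$, if $\lambda_c\ge0$ satisfies $\big(\frac{\max\{1,\lambda_c+\gamma\}}{1+\lambda_c-\gamma}\big)^{0.17k}\le\frac{1}{16e^3\Delta^2k^4}$, then $Z^{\mathrm{CNF}}_{\Phi,\mathcal M}(\lambda)\neq0$ for every $\lambda$ with $|\lambda-\lambda_c|\le\gamma$.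
   Context: A $(k,\Delta)$-CNF formula is a CNF formula over Boolean variables $V$ (values $0$ = False, $1$ = True) in which every clause contains exactly $k$ variables and every variable belongs to at most $\Delta$ clauses. $\Omega_\Phi\subseteq\{0,1\}^V$ is its set of satisfying assignments. For $\mathcal M\subseteq V$, $Z^{\mathrm{CNF}}_{\Phi,\mathcal M}(\lambda)=\sum_{\sigma\in\Omega_\Phi}\lambda^{|\mathcal M\cap\sigma^{-1}(1)|}$, where $\sigma^{-1}(1)=\{v:\sigma(v)=1\}$.
   Formalization: The case |V| = 1 is excluded: there the only formula has no clauses, and no set M satisfies |V|/6 ≤ |M| ≤ 4|V|/5, so the claim as stated is false. *)

(* Defs.v *)
From HB Require Import structures.
From mathcomp Require Import all_boot all_order all_algebra.
From mathcomp Require Import complex.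
From mathcomp Require Import all_classical all_reals all_analysis.

Set Implicit Arguments.
Unset Strict Implicit.
Unset Printing Implicit Defensive.

Import Order.TTheory GRing.Theory Num.Theory.

Local Open Scope ring_scope.

Section CNF.

Variable V : finType.

(* (v, true) is the literal v, (v, false) is its negation. *)
Definition literal : Type := (V * bool)%type.
Definition clause : Type := {set V * bool}.
(* A formula is the conjunction of a finite list of clauses; repeated clauses
   are allowed and count with multiplicity in the degree of a variable. *)
Definition cnf : Type := seq clause.

Definition clause_vars (c : clause) : {set V} := [set l.1 | l in c].

Definition is_kD_cnf (k D : nat) (Phi : cnf) : Prop :=
  (forall c : clause, c \in Phi -> #|clause_vars c| = k) /\
  (forall v : V, (count (fun c : clause => v \in clause_vars c) Phi <= D)%N).

Definition clause_sat (s : {ffun V -> bool}) (c : clause) : bool :=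
  [exists l in c, s l.1 == l.2].

Definition sat_assignments (Phi : cnf) : {set {ffun V -> bool}} :=
  [set s : {ffun V -> bool} | all (clause_sat s) Phi].

Definition Z_CNF (A : pzRingType) (Phi : cnf) (M : {set V}) (lambda : A) : A :=
  \sum_(s in sat_assignments Phi) lambda ^+ #|M :&: [set v | s v]|.

End CNF.

Definition log2 (R : realType) (x : R) : R := ln x / ln 2.

Definition gamma_CNF (R : realType) (k D : nat) : R :=
  (2000 * D%:R ^+ 2 * k%:R ^+ 5)^-1.

(* Main.v *)
Require Import Defs.
From HB Require Import structures.
From mathcomp Require Import all_boot all_order all_algebra.
From mathcomp Require Import complex.
From mathcomp Require Import all_classical all_reals all_analysis.
From mathcomp Require Import ring lra zify.

Set Implicit Arguments.
Unset Strict Implicit.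
Unset Printing Implicit Defensive.

Import Order.TTheory GRing.Theory Num.Theory.

Local Open Scope ring_scope.
Local Open Scope complex_scope.

(* Any M of size |V|/2 works. Dividing by (1 + lambda)^|M| 2^(|V| - |M|) turns Z
   into the mass of the satisfying assignments under a complex product measure
   whose weights have modulus at most r, with r^k tiny, and |b_v(0)| + |b_v(1)|
   barely above 1. A complex local lemma by induction on the number of clauses
   then gives |Z(c, F) - Z(F)| <= 4 r^k |Z(F)|. The difference is the partition
   function with the k variables of c pinned so as to violate c, and a pinned
   partition function is at most the one of the untouched clauses times a product
   of factors 1 + charge. To bound it, pick a touched unsatisfied clause: if its
   remaining violation weight is small, remove it; otherwise reveal one of its
   free variables, which strictly decreases the expected charge. *)

(** * Partition functions with some variables pinned *)

(* A clause is given by its set of variables [W i] together with the unique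
   assignment [phi i] of these variables that violates it. *)
Section PinnedPartition.

Context (K : comPzRingType) (V I : finType).
Context (W : I -> {set V}) (phi : I -> V -> bool) (b : V -> bool -> K).

Implicit Types (A B : {set V}) (F : {set I}) (s : {ffun V -> bool}) (t p : V -> bool).

Definition agree A t (s : V -> bool) := [forall v in A, s v == t v].

Definition avoids s F := [forall i in F, ~~ agree (W i) (phi i) s].

Definition patch t B p : V -> bool := fun v => if v \in B then p v else t v.

(** Pinned variables carry no weight, so this is a conditional mass: once the weights at each
    variable sum to 1, pinning variables that no clause of [F] meets leaves it unchanged. *)
Definition Zpin A t F : K :=
  \sum_(s : {ffun V -> bool} | agree A t s && avoids s F)
    \prod_(v in ~: A) b v (s v).

Definition Zfree F : K := Zpin finset.set0 xpred0 F.

Lemma agreeP A t (s : V -> bool) : reflect {in A, s =1 t} (agree A t s).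
Proof. by apply: (iffP forall_inP) => h v vA; apply/eqP; rewrite ?h//; exact/eqP/h. Qed.

Lemma eq_Zpin A t t' F : {in A, t =1 t'} -> Zpin A t F = Zpin A t' F.
Proof.
move=> e; apply: eq_bigl => s; congr (_ && _).
by apply/agreeP/agreeP => h v vA; rewrite h ?e.
Qed.

Lemma avoidsU1 s i F :
  avoids s (i |: F) = ~~ agree (W i) (phi i) s && avoids s F.
Proof.
apply/forall_inP/andP => [h|[hi /forall_inP hF] j].
  split; first by apply: h; rewrite !inE eqxx.
  by apply/forall_inP => j jF; apply: h; rewrite !inE jF orbT.
by rewrite !inE => /orP[/eqP->//|]; exact: hF.
Qed.

Lemma agree_patch A t i (s : V -> bool) :
  agree (W i :&: A) t (phi i) ->
  agree A t s && agree (W i) (phi i) s =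
  agree (A :|: W i) (patch t (W i) (phi i)) s.
Proof.
move=> /agreeP comp; apply/andP/agreeP => [[/agreeP hA /agreeP hW] v|h].
  rewrite inE /patch; case: ifP => [vW _|_]; first exact: hW.
  by rewrite orbF; exact: hA.
split; apply/agreeP => v vX.
  rewrite h ?inE ?vX// /patch; case: ifP => // vW.
  by apply: comp; rewrite inE vW.
by rewrite h ?inE ?vX ?orbT// /patch vX.
Qed.

(** The assignments lost by adding clause [i] are those that violate it, that is, those also pinned
    to [phi i] on [W i]; the newly pinned variables leave their weights as a prefactor. *)
Lemma Zpin_clause A t i F :
  agree (W i :&: A) t (phi i) ->
  Zpin A t (i |: F) = Zpin A t F
    - (\prod_(v in W i :\: A) b v (phi i v))
      * Zpin (A :|: W i) (patch t (W i) (phi i)) F.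
Proof.
move=> comp.
suff -> : (\prod_(v in W i :\: A) b v (phi i v))
      * Zpin (A :|: W i) (patch t (W i) (phi i)) F =
    \sum_(s : {ffun V -> bool} | agree A t s && avoids s F && agree (W i) (phi i) s)
      \prod_(v in ~: A) b v (s v).
  rewrite {2}/Zpin (bigID (fun s : {ffun V -> bool} => agree (W i) (phi i) s))/=.
  by rewrite addrC addrK; apply: eq_bigl => s; rewrite avoidsU1 andbCA andbC.
rewrite mulr_sumr; apply: eq_big => [s|s /andP[/agreeP hs _]].
  by rewrite -agree_patch// andbAC.
rewrite [RHS](bigID [in W i])/=; congr (_ * _).
  apply: eq_big => [v|v]; first by rewrite !inE andbC.
  by rewrite !inE => /andP[_ vW]; rewrite hs ?inE ?vW ?orbT// /patch vW.
by apply: eq_bigl => v; rewrite !inE negb_or.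
Qed.

Lemma Zpin_sat A t i F :
  ~~ agree (W i :&: A) t (phi i) -> Zpin A t (i |: F) = Zpin A t F.
Proof.
move=> comp; apply: eq_bigl => s; rewrite avoidsU1.
case: (boolP (agree A t s)) => //= /agreeP hA.
case: (boolP (agree (W i) (phi i) s)) => //= /agreeP hW.
case/negP: comp; apply/agreeP => v; rewrite inE => /andP[vW vA].
by rewrite -hW// hA.
Qed.

Lemma Zpin_violated A t i F :
  i \in F -> W i \subset A -> agree (W i :&: A) t (phi i) -> Zpin A t F = 0.
Proof.
move=> iF /fintype.subsetP sWA /agreeP comp; apply: big_pred0 => s; apply/negP.
case/andP=> /agreeP hA /forall_inP /(_ _ iF) /agreeP[] v vW.
by rewrite hA ?sWA// comp// inE vW sWA.
Qed.

Lemma Zpin_reveal A t F v (x : bool) : v \notin A ->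
  Zpin A t F =
    b v x * Zpin (v |: A) (patch t [set v]%SET (fun=> x)) F
  + b v (~~ x) * Zpin (v |: A) (patch t [set v]%SET (fun=> ~~ x)) F.
Proof.
move=> vA.
have part (y : bool) :
  b v y * Zpin (v |: A) (patch t [set v]%SET (fun=> y)) F =
  \sum_(s : {ffun V -> bool} | agree A t s && avoids s F && (s v == y))
    \prod_(u in ~: A) b u (s u).
  rewrite mulr_sumr; apply: eq_big => [s|s /andP[/agreeP h _]].
    rewrite [RHS]andbAC; congr (_ && _); apply/agreeP/andP => [h|[/agreeP h /eqP e] u].
      split; last by rewrite h ?inE ?eqxx// /patch inE eqxx.
      apply/agreeP => u uA; rewrite h ?inE ?uA ?orbT// /patch inE.
      by case: eqP => // e; rewrite -e uA in vA.
    by rewrite !inE /patch inE; case: eqP => [->//|_] /=; exact: h.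
  rewrite [RHS](bigD1 v) ?inE//= h ?inE ?eqxx// /patch inE eqxx; congr (_ * _).
  by apply: eq_bigl => u; rewrite !inE negb_or andbC.
rewrite !part [LHS](bigID (fun s : {ffun V -> bool} => s v == x))/=; congr (_ + _).
by apply: eq_bigl => s; congr (_ && _); case: (s v); case: (x).
Qed.

Hypothesis b_sum : forall v, b v false + b v true = 1.

(** Toggling the value at [v] is a bijection that no clause of [F] notices. *)
Lemma Zpin_flip A t F v (x : bool) : v \notin A ->
  {in F, forall i, v \notin W i} ->
  Zpin (v |: A) (patch t [set v]%SET (fun=> x)) F =
  Zpin (v |: A) (patch t [set v]%SET (fun=> ~~ x)) F.
Proof.
move=> vA vF; pose flip (s : {ffun V -> bool}) := [ffun u => if u == v then ~~ s u else s u].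
have flipK : involutive flip.
  by move=> s; apply/ffunP => u; rewrite !ffunE; case: (u == v); rewrite ?negbK.
rewrite /Zpin (reindex_inj (inv_inj flipK))/=; apply: eq_big => [s|s _].
  congr (_ && _).
    apply/agreeP/agreeP => h u uA; have := h u uA; rewrite ffunE /patch inE.
      by case: eqP => // _; case: (s u); case: (x).
    by case: eqP => // _ ->; rewrite negbK.
  have e : {in F, forall i, agree (W i) (phi i) (flip s) = agree (W i) (phi i) s}.
    move=> i iF; apply/agreeP/agreeP => h u uW; have := h u uW; rewrite ffunE;
    by case: eqP => // uv; have := vF _ iF; rewrite -uv uW.
  by apply/forall_inP/forall_inP => h i iF; have := h i iF; rewrite e.
apply: eq_bigr => u; rewrite !inE negb_or => /andP[/negPf uv _].
by rewrite ffunE uv.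
Qed.

(** Variables are unpinned one at a time: the unpinned value is an average, with weights summing to
    1, of two values that [Zpin_flip] makes equal. *)
Lemma Zpin_free A t F : {in F, forall i, [disjoint W i & A]} -> Zpin A t F = Zfree F.
Proof.
move: {2}#|A| (leqnn #|A|) => n; elim: n A t => [|n IH] A t.
  rewrite leqn0 cards_eq0 => /eqP-> _.
  by apply: eq_Zpin => v; rewrite inE.
move=> cA hF; have [->|[v vA]] := set_0Vmem A.
  by apply: eq_Zpin => v; rewrite inE.
have hF' : {in F, forall i, [disjoint W i & A :\ v]}.
  move=> i iF; apply: disjointWr (hF i iF); exact: subsetDl.
rewrite -(IH (A :\ v) t)//; last by move: cA; rewrite (cardsD1 v) vA.
have vN : v \notin A :\ v by rewrite !inE eqxx.
have vF : {in F, forall i, v \notin W i}.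
  move=> i iF; apply: contraL (hF i iF) => vW.
  by apply/pred0Pn; exists v; rewrite /= vW.
rewrite (Zpin_reveal t F false vN) (Zpin_flip t true vN vF)/= -mulrDl b_sum mul1r.
case tv: (t v); first rewrite (Zpin_flip t false vN vF);
  by rewrite (finset.setD1K vA); apply: eq_Zpin => u _; rewrite /patch inE; case: eqP => // ->.
Qed.

Lemma Zfree0 : Zfree finset.set0 = 1.
Proof.
rewrite /Zfree /Zpin; transitivity (\prod_(v : V) \sum_(x : bool) b v x); last first.
  by apply: big1 => v _; rewrite big_bool/= addrC b_sum.
rewrite bigA_distr_bigA/=; apply: eq_big => [s|s _].
  apply/andP; split; first by apply/agreeP => v; rewrite inE.
  by apply/forall_inP => i; rewrite inE.
by apply: eq_bigl => v; rewrite !inE.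
Qed.

End PinnedPartition.

(** * Elementary inequalities for powers and products *)

Section PowerEstimates.

Context (R : realFieldType).

Lemma bernoulli_le (x : R) n : x <= 1 -> 1 - n%:R * x <= (1 - x) ^+ n.
Proof.
move=> x1; elim: n => [|n IH]; first by rewrite mul0r subr0 expr0.
case: (lerP (1 - n.+1%:R * x) 0) => [h|h].
  by apply: (le_trans h); rewrite exprn_ge0// subr_ge0.
rewrite exprS; apply: (@le_trans _ _ ((1 - x) * (1 - n%:R * x))).
  have : 0 <= n%:R * x ^+ 2 by rewrite mulr_ge0 ?sqr_ge0.
  rewrite -natr1; nra.
by rewrite ler_wpM2l// subr_ge0.
Qed.

(** Both bounds have the exact linear term, so products of charges can be compared through their
    sums, with only a quadratic error. *)
Lemma prod1D_bounds (J : Type) (s : seq J) (P : pred J) (g : J -> R) :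
  (forall j, 0 <= g j) ->
  1 + \sum_(j <- s | P j) g j <= \prod_(j <- s | P j) (1 + g j) /\
  (\sum_(j <- s | P j) g j <= 1 -> \prod_(j <- s | P j) (1 + g j) <=
    1 + \sum_(j <- s | P j) g j + (\sum_(j <- s | P j) g j) ^+ 2).
Proof.
move=> g0; elim: s => [|j s [IH1 IH2]]; first by rewrite !big_nil; split=> *; lra.
rewrite !big_cons; case: (P j) => //.
have S0 : 0 <= \sum_(j <- s | P j) g j by apply: sumr_ge0.
have gj := g0 j; split=> [|h]; first nra.
have {}IH2 := IH2 ltac:(lra).
move: S0 IH1 IH2 h; set S := \sum_(j <- s | P j) g j; set Q := \prod_(j <- s | P j) _.
move=> S0 _ IH2 h; apply: (@le_trans _ _ ((1 + g j) * (1 + S + S ^+ 2))).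
  by rewrite ler_wpM2l//; lra.
have : g j * S ^+ 2 <= g j * S by rewrite expr2 ler_wpM2l// ler_piMr//; lra.
have := sqr_ge0 (g j); nra.
Qed.

End PowerEstimates.

(** * A local lemma for ring-valued weights with a multiplicative norm *)

Section LocalLemma.

Context (R : realFieldType) (K : comPzRingType) (N : K -> R).
Hypothesis N_ge0 : forall x, 0 <= N x.
Hypothesis N0 : N 0 = 0.
Hypothesis N1 : N 1 = 1.
Hypothesis NM : forall x y, N (x * y) = N x * N y.
Hypothesis NN : forall x, N (- x) = N x.
Hypothesis ND : forall x y, N (x + y) <= N x + N y.

Context (V I : finType) (W : I -> {set V}) (phi : I -> V -> bool) (b : V -> bool -> K).
Hypothesis b_sum : forall v, b v false + b v true = 1.

(** [r] bounds one weight, [kappa] the total norm of the weights at one variable, [eta] one charge;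
    [eps] will bound the relative change of the partition function caused by one clause. *)
Context (k D : nat) (r kappa eta : R).
Let eps : R := 4 * r ^+ k.

Hypothesis b_le : forall v x, N (b v x) <= r.
Hypothesis b_kappa : forall v, N (b v false) + N (b v true) <= kappa.
Hypothesis W_card : forall i, #|W i| = k.
Hypothesis W_deg : forall v, (#|[set i | v \in W i]%SET| <= D)%N.
Hypothesis r_ge0 : 0 <= r.
Hypothesis r_le1 : r <= 1.
Hypothesis eps_lt1 : eps < 1.
Hypothesis eta_ge0 : 0 <= eta.
Hypothesis D_eta : D%:R * eta <= 1.
(** Pinning a whole clause affects at most [k * D] clauses and may cost a factor 4. In
    [reveal_cost], the drift [(1 - r) * eta] of a saturated clause pays for the excess of [kappa]
    over 1, the newly touched clauses and the second-order terms. *)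
Hypothesis touch_cost : (1 + eta) ^+ (k * D) <= 4 * (1 - eps) ^+ (k * D).
Hypothesis reveal_cost :
  kappa - 1 + 3 * (D%:R * eps) + kappa * (D%:R * eta) ^+ 2 <= (1 - r) * eta.

Implicit Types (A B : {set V}) (F G : {set I}) (t p : V -> bool).

Let agr A t i := agree (W i :&: A) t (phi i).
Let Z A t F := Zpin W phi b A t F.
Let Z0 F := Zfree W phi b F.

(* [1 + charge A t i] bounds the factor by which clause [i] can increase the
   partition function once [A] is pinned to [t]. The truncation at [eta] keeps
   the total charge of the clauses meeting one variable small. *)
Definition charge A t i : R :=
  if [disjoint W i & A] || ~~ agr A t i then 0
  else Num.min eta (4 * \prod_(v in W i :\: A) N (b v (phi i v))).

Definition untouched A F := [set i in F | [disjoint W i & A]]%SET.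

Let cost A t F := \prod_(i in F) (1 + charge A t i) * N (Z0 (untouched A F)).

Lemma eps_ge0 : 0 <= eps.
Proof. by rewrite mulr_ge0 ?exprn_ge0. Qed.

Lemma N_prod (P : pred V) (g : V -> K) :
  N (\prod_(v | P v) g v) = \prod_(v | P v) N (g v).
Proof. by apply: (big_morph N). Qed.

Lemma prod_N_ge0 A (s : V -> bool) : 0 <= \prod_(v in A) N (b v (s v)).
Proof. by apply: prodr_ge0. Qed.

Lemma prod_N_le A (s : V -> bool) : \prod_(v in A) N (b v (s v)) <= r ^+ #|A|.
Proof.
rewrite -prodr_const; apply: ler_prod => v _; by rewrite N_ge0 b_le.
Qed.

Lemma charge_ge0 A t i : 0 <= charge A t i.
Proof.
rewrite /charge; case: ifP => // _.
by rewrite le_min eta_ge0/= mulr_ge0// prod_N_ge0.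
Qed.

Lemma charge_le A t i : charge A t i <= eta.
Proof. by rewrite /charge; case: ifP => // _; rewrite ge_min lexx. Qed.

Lemma card_touched B : (#|[set i | ~~ [disjoint W i & B]]%SET| <= #|B| * D)%N.
Proof.
rewrite -sum_nat_const; apply: (@leq_trans (\sum_(v in B) #|[set i | v \in W i]%SET|));
  last exact: leq_sum.
pose U := (\bigcup_(v in B) [set i | v \in W i])%SET.
apply: (@leq_trans #|U|).
  apply: subset_leq_card; apply/fintype.subsetP => i; rewrite inE.
  case/pred0Pn => v /andP[/= vW vB]; apply/bigcupP; exists v => //.
  by rewrite inE.
rewrite /U; elim/big_rec2: _ => [|v n S _ le]; first by rewrite cards0.
by apply: (leq_trans (leq_card_setU _ _)); rewrite leq_add2l.
Qed.

Lemma disjointU i A B : [disjoint W i & A :|: B] = [disjoint W i & A] && [disjoint W i & B].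
Proof. by rewrite -!setI_eq0 finset.setIUr finset.setU_eq0. Qed.

Lemma charge_patch A t B p i : [disjoint W i & B] ->
  charge (A :|: B) (patch t B p) i = charge A t i.
Proof.
move=> dB; rewrite /charge disjointU dB andbT.
have eI : W i :&: (A :|: B) = W i :&: A.
  by rewrite finset.setIUr (disjoint_setI0 dB) finset.setU0.
have eD : W i :\: (A :|: B) = W i :\: A.
  by rewrite -finset.setDDl; apply/finset.setDidPl; apply: disjointWl dB; exact: subsetDl.
rewrite eD /agr eI.
have -> : agree (W i :&: A) (patch t B p) (phi i) = agree (W i :&: A) t (phi i).
  apply/agreeP/agreeP => h v vWA; have := h v vWA; rewrite /patch ifF//;
  by apply: (disjointFr dB); move: vWA; rewrite inE => /andP[].
by [].
Qed.

(** One half of a simultaneous induction on the number of clauses; the other half is [pin_bound]. *)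
Definition small_ratio n := forall i F, i \notin F -> (#|F| < n)%N ->
  N (Z0 (i |: F) - Z0 F) <= eps * N (Z0 F).

(** Telescoping: the clauses of [G :\: F] are added one by one, and each keeps at least a fraction
    [1 - eps] of the norm. *)
Lemma small_ratio_sub n F G m : small_ratio n ->
  F \subset G -> (#|G| <= n)%N -> (#|G :\: F| <= m)%N ->
  N (Z0 F) * (1 - eps) ^+ m <= N (Z0 G).
Proof.
move=> An; have e1 : 0 <= 1 - eps by have := eps_lt1; lra.
have e2 : 1 - eps <= 1 by have := eps_ge0; lra.
elim: m G => [|m IH] G sFG cG cD.
  rewrite expr0 mulr1 (_ : F = G)//; apply/eqP; rewrite finset.eqEsubset sFG.
  by rewrite -finset.setD_eq0 -cards_eq0 -leqn0.
have [e|[i iGF]] := set_0Vmem (G :\: F).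
  apply: (@le_trans _ _ (N (Z0 F) * (1 - eps) ^+ m)).
    by rewrite ler_wpM2l// exprSr ler_piMr// exprn_ge0.
  by apply: IH => //; rewrite e cards0.
have /setDP[iG iF] := iGF.
have cG1 : (#|G :\ i| < n)%N by move: cG; rewrite (cardsD1 i) iG.
have := IH (G :\ i); rewrite finset.subsetD1 sFG iF => /(_ isT (ltnW cG1)).
have -> : (G :\ i) :\: F = (G :\: F) :\ i.
  by apply/setP => j; rewrite !inE; case: (j \in F); rewrite ?andbF//= ?andbT.
have -> : (#|(G :\: F) :\ i| <= m)%N by move: cD; rewrite (cardsD1 i) iGF.
move=> /(_ isT) h.
have := An i (G :\ i); rewrite finset.setD1K// !inE eqxx => /(_ isT cG1) a.
have tri : N (Z0 (G :\ i)) <= N (Z0 G) + N (Z0 G - Z0 (G :\ i)).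
  by rewrite -[N (_ - _)]NN opprB; have := ND (Z0 G) (Z0 (G :\ i) - Z0 G); rewrite addrC subrK.
rewrite exprSr mulrA; apply: (@le_trans _ _ (N (Z0 (G :\ i)) * (1 - eps))).
  by rewrite ler_wpM2r.
by rewrite mulrBr mulr1; lra.
Qed.

Lemma untouchedU A B F : untouched (A :|: B) F = untouched B (untouched A F).
Proof. by apply/setP => i; rewrite !inE disjointU andbA. Qed.

Lemma untouched_sub B F : untouched B F \subset F.
Proof. by apply/fintype.subsetP => i; rewrite inE => /andP[]. Qed.

Lemma small_ratio_untouched n A B F : small_ratio n -> (#|untouched A F| <= n)%N ->
  N (Z0 (untouched (A :|: B) F)) * (1 - eps) ^+ (#|B| * D) <= N (Z0 (untouched A F)).
Proof.
move=> An cF; rewrite untouchedU; apply: (small_ratio_sub An) => //.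
  exact: untouched_sub.
apply: leq_trans (card_touched B); apply: subset_leq_card; apply/fintype.subsetP => i.
by rewrite !inE; case: (_ \in F); case: [disjoint _ & A]; case: [disjoint _ & B].
Qed.

(** Only the clauses meeting [B] change their charge, and none exceeds [eta]. *)
Lemma prod_charge_patch A t B p F :
  \prod_(i in F) (1 + charge (A :|: B) (patch t B p) i) <=
  (1 + eta) ^+ (#|B| * D) * \prod_(i in F) (1 + charge A t i).
Proof.
have eta1 : 1 <= 1 + eta by rewrite lerDl.
apply: (@le_trans _ _ (\prod_(i in F) ((if ~~ [disjoint W i & B] then 1 + eta else 1) *
    (1 + charge A t i)))).
  apply: ler_prod => i _; apply/andP; split; first by rewrite addr_ge0 ?charge_ge0.
  case: (boolP [disjoint W i & B]) => /= dB; first by rewrite charge_patch// mul1r.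
  have := charge_le (A :|: B) (patch t B p) i; have := charge_ge0 A t i.
  have := eta_ge0; nra.
rewrite big_split/= ler_wpM2r//.
  by apply: prodr_ge0 => i _; rewrite addr_ge0 ?charge_ge0.
rewrite -big_mkcondr/= prodr_const ler_weXn2l//.
apply: leq_trans (card_touched B); apply: subset_leq_card; apply/fintype.subsetP => i.
by rewrite !inE => /andP[].
Qed.

Lemma cost_ge0 A t F : 0 <= cost A t F.
Proof. by rewrite mulr_ge0// prodr_ge0// => i _; rewrite addr_ge0 ?charge_ge0. Qed.

Lemma cost_pin n A t i F : small_ratio n -> (#|untouched A F| <= n)%N ->
  cost (A :|: W i) (patch t (W i) (phi i)) F <= 4 * cost A t F.
Proof.
move=> An cF; have e1 : 0 < 1 - eps by have := eps_lt1; lra.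
have h1 := prod_charge_patch A t (W i) (phi i) F.
have h2 := small_ratio_untouched (W i) An cF.
rewrite W_card in h1 h2; rewrite /cost; set P := \prod_(i in F) _ in h1 *.
set Q := \prod_(i in F) _ in h1 *.
have Q0 : 0 <= Q by apply: prodr_ge0 => j _; rewrite addr_ge0 ?charge_ge0.
apply: (le_trans (ler_wpM2r (N_ge0 _) h1)).
apply: (@le_trans _ _ (4 * (1 - eps) ^+ (k * D) * Q * N (Z0 (untouched (A :|: W i) F)))).
  by rewrite ler_wpM2r// ler_wpM2r.
have -> : 4 * (1 - eps) ^+ (k * D) * Q * N (Z0 (untouched (A :|: W i) F)) =
  4 * (Q * (N (Z0 (untouched (A :|: W i) F)) * (1 - eps) ^+ (k * D))) by ring.
by rewrite ler_wpM2l// ler_wpM2l.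
Qed.

(** * Evolution of the charges when one variable is revealed *)

Lemma charge_reveal_sat A t i v : v \in W i ->
  charge (v |: A) (patch t [set v]%SET (fun=> ~~ phi i v)) i = 0.
Proof.
move=> vW; rewrite /charge ifT//; apply/orP; right; apply/negP => /agreeP /(_ v).
by rewrite !inE vW eqxx /patch inE eqxx => /(_ isT); case: (phi i v).
Qed.

(** For a clause already touched, the weight of [v] restores the factor missing from the remaining
    product, so nothing is gained. A clause touched for the first time had charge 0, and its full
    weight contributes at most [4 * r ^+ k = eps]. *)
Lemma charge_reveal_viol A t i v : v \in W i -> v \notin A ->
  N (b v (phi i v)) * charge (v |: A) (patch t [set v]%SET (fun=> phi i v)) i
  <= charge A t i + eps.
Proof.
move=> vW vA; rewrite /charge.
have -> : [disjoint W i & v |: A] = false.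
  by apply/negP => /pred0P /(_ v); rewrite /= !inE vW eqxx.
have -> : agr (v |: A) (patch t [set v]%SET (fun=> phi i v)) i = agr A t i.
  apply/agreeP/agreeP => h u; rewrite !inE => /andP[uW].
    move=> uA; have := h u; rewrite !inE uW uA orbT /patch inE => /(_ isT) ->.
    by case: eqP => // uv; rewrite -uv uA in vA.
  by rewrite /patch inE; case: eqP => [->//|_] /= uA; apply: h; rewrite inE uW.
case: (boolP (agr A t i)) => [ag|_]; last first.
  by rewrite /= orbT mulr0 add0r eps_ge0.
rewrite /= orbF; have pe : \prod_(u in W i :\: A) N (b u (phi i u)) =
    N (b v (phi i v)) * \prod_(u in W i :\: (v |: A)) N (b u (phi i u)).
  rewrite (bigD1 v) ?inE ?vA//=; congr (_ * _).
  by apply: eq_bigl => u; rewrite !inE negb_or andbC andbA.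
have Nle : N (b v (phi i v)) <= 1 by apply: le_trans (b_le _ _) _.
set P := \prod_(u in W i :\: (v |: A)) _ in pe *.
have le4 : N (b v (phi i v)) * Num.min eta (4 * P) <=
    4 * \prod_(u in W i :\: A) N (b u (phi i u)).
  rewrite pe mulrCA ler_wpM2l// ge_min lexx orbT//.
have leeta : N (b v (phi i v)) * Num.min eta (4 * P) <= eta.
  apply: (@le_trans _ _ (1 * eta)); last by rewrite mul1r.
  apply: ler_pM => //; last by rewrite ge_min lexx.
  by rewrite le_min eta_ge0 mulr_ge0// prodr_ge0.
case: (boolP [disjoint W i & A]) => dA; last first.
  by rewrite ler_wpDr ?eps_ge0// le_min leeta.
rewrite add0r; apply: (le_trans le4); rewrite ler_wpM2l//.
rewrite (_ : W i :\: A = W i); last by apply/finset.setDidPl.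
by rewrite -(W_card i) prod_N_le.
Qed.

Lemma charge_reveal A t i v x : v \in W i -> v \notin A ->
  N (b v x) * charge (v |: A) (patch t [set v]%SET (fun=> x)) i
  + N (b v (~~ x)) * charge (v |: A) (patch t [set v]%SET (fun=> ~~ x)) i
  <= charge A t i + eps.
Proof.
move=> vW vA; have h1 := charge_reveal_sat A t vW; have h2 := charge_reveal_viol t vW vA.
case: (eqVneq x (phi i v)) => [->|].
  by rewrite h1 mulr0 addr0.
move=> ne; have {ne} -> : x = ~~ phi i v by case: x (phi i v) ne => [] [].
by rewrite negbK h1 mulr0 add0r.
Qed.

(* Charges are bounded by [eta], so the quadratic term of the product over the
   clauses containing [v] is negligible, and to first order revealing [v] does
   not increase the charges, while the saturated clause [d] loses
   [(1 - r) * eta] of its charge on average. *)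
Lemma reveal_gain A t (T : {set I}) d v x :
  T \subset [set i | v \in W i] -> d \in T -> v \notin A -> charge A t d = eta ->
  N (b v x) * \prod_(i in T) (1 + charge (v |: A) (patch t [set v]%SET (fun=> x)) i)
  + N (b v (~~ x)) *
    \prod_(i in T) (1 + charge (v |: A) (patch t [set v]%SET (fun=> ~~ x)) i)
  <= (1 - eps) ^+ D * \prod_(i in T) (1 + charge A t i).
Proof.
move=> /fintype.subsetP sT dT vA chd.
have cT : (#|T| <= D)%N.
  by apply: leq_trans (W_deg v); apply: subset_leq_card; apply/fintype.subsetP.
have cTR : #|T|%:R <= D%:R :> R by rewrite ler_nat.
have vW i : i \in T -> v \in W i by move=> /sT; rewrite inE.
have sle (A' : {set V}) t' : \sum_(i in T) charge A' t' i <= D%:R * eta.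
  apply: (@le_trans _ _ (\sum_(i in T) eta)); first by apply: ler_sum => i _; exact: charge_le.
  by rewrite sumr_const -[leLHS]mulr_natl ler_wpM2r.
have sge (A' : {set V}) t' : 0 <= \sum_(i in T) charge A' t' i.
  by apply: sumr_ge0 => i _; exact: charge_ge0.
have ple y : \prod_(i in T) (1 + charge (v |: A) (patch t [set v]%SET (fun=> y)) i) <=
    1 + \sum_(i in T) charge (v |: A) (patch t [set v]%SET (fun=> y)) i + (D%:R * eta) ^+ 2.
  have [_ h] := prod1D_bounds (index_enum I) [in T]
    (charge_ge0 (v |: A) (patch t [set v]%SET (fun=> y))).
  apply: (le_trans (h (le_trans (sle _ _) D_eta))).
  by rewrite lerD2l ler_sqr ?sle// nnegrE ?sge// mulr_ge0.
have [pge _] := prod1D_bounds (index_enum I) [in T] (charge_ge0 A t).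
set S := \sum_(i in T) charge A t i in pge.
have S1 : S <= 1 by apply: le_trans (sle _ _) D_eta.
have S0 : 0 <= S by exact: sge.
(* First-order drift: [d] retains at most [r * eta], since one value of [v] satisfies it and its
   charge cannot rise above the cap; every other clause gains at most [eps]. *)
have key : N (b v x) * \sum_(i in T) charge (v |: A) (patch t [set v]%SET (fun=> x)) i
  + N (b v (~~ x)) * \sum_(i in T) charge (v |: A) (patch t [set v]%SET (fun=> ~~ x)) i
  <= S + D%:R * eps - (1 - r) * eta.
  rewrite !mulr_sumr -big_split/= /S (bigD1 d)//= [X in _ <= X + _ - _](bigD1 d)//= chd.
  have hd : N (b v x) * charge (v |: A) (patch t [set v]%SET (fun=> x)) d
    + N (b v (~~ x)) * charge (v |: A) (patch t [set v]%SET (fun=> ~~ x)) d <= r * eta.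
    have h1 := charge_reveal_sat A t (vW _ dT).
    have h2 (u : bool) : N (b v u) * charge (v |: A) (patch t [set v]%SET (fun=> u)) d <= r * eta.
      by apply: ler_pM => //; [exact: charge_ge0 | exact: charge_le].
    case: (eqVneq x (phi d v)) => [->|]; first by rewrite h1 mulr0 addr0.
    move=> ne; have {ne} -> : x = ~~ phi d v by case: x (phi d v) ne => [] [].
    by rewrite negbK h1 mulr0 add0r.
  have hr : \sum_(i in T | i != d) (N (b v x) * charge (v |: A) (patch t [set v]%SET (fun=> x)) i
    + N (b v (~~ x)) * charge (v |: A) (patch t [set v]%SET (fun=> ~~ x)) i) <=
    \sum_(i in T | i != d) charge A t i + D%:R * eps.
    apply: (@le_trans _ _ (\sum_(i in T | i != d) (charge A t i + eps))).
      by apply: ler_sum => i /andP[iT _]; apply: charge_reveal => //; exact: vW.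
    rewrite big_split/= lerD2l sumr_const -[leLHS]mulr_natl ler_wpM2r ?eps_ge0// ler_nat.
    apply: leq_trans cT; apply: subset_leq_card; apply/fintype.subsetP => i.
    by rewrite unfold_in => /andP[].
  rewrite mulrBl mul1r; move: hd hr; lra.
have kap : N (b v x) + N (b v (~~ x)) <= kappa.
  by case: x {key} => /=; rewrite ?[N (b v true) + _]addrC; exact: b_kappa.
have e0 := eps_ge0.
have De : 0 <= D%:R * eps by rewrite mulr_ge0.
(* Since [1 + S] is at most 2, this accounts for two of the three terms [D%:R * eps] in
   [reveal_cost]; the third comes from [key]. *)
have bern : 1 - D%:R * eps <= (1 - eps) ^+ D by apply: bernoulli_le; exact: ltW.
have e1 : 0 <= (1 - eps) ^+ D by rewrite exprn_ge0//; have := eps_lt1; lra.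
apply: (@le_trans _ _ ((1 - eps) ^+ D * (1 + S))); last by rewrite ler_wpM2l.
apply: (@le_trans _ _ ((1 - D%:R * eps) * (1 + S))); last by rewrite ler_wpM2r//; lra.
have SD : S * (D%:R * eps) <= D%:R * eps by rewrite ler_piMl.
have q1 := ler_wpM2l (N_ge0 (b v x)) (ple x).
have q2 := ler_wpM2l (N_ge0 (b v (~~ x))) (ple (~~ x)).
apply: (le_trans (lerD q1 q2)).
have q3 : (N (b v x) + N (b v (~~ x))) * (D%:R * eta) ^+ 2 <= kappa * (D%:R * eta) ^+ 2.
  by rewrite ler_wpM2r// sqr_ge0.
have := reveal_cost; move: key q3 SD kap; set a := D%:R * eps; set c := (D%:R * eta) ^+ 2.
move: (\sum_(i in T) charge (v |: A) (patch t [set v]%SET (fun=> x)) i)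
  (\sum_(i in T) charge (v |: A) (patch t [set v]%SET (fun=> ~~ x)) i) => s1 s2 key q3 SD kap cost_le; lra.
Qed.

(** * Bounding pinned partition functions by their cost *)

Lemma cost_touched A t i F : i \notin F -> ~~ [disjoint W i & A] ->
  cost A t (i |: F) = (1 + charge A t i) * cost A t F.
Proof.
move=> iF dA; rewrite /cost big_setU1//= mulrA; congr (_ * N (Z0 _)).
by apply/setP => j; rewrite !inE; case: eqP => // ->; rewrite (negPf dA) !andbF.
Qed.

Definition pin_bound n := forall A t F, (#|F| < n)%N -> N (Z A t F) <= cost A t F.

Lemma pin_bound_untouched A t F :
  {in F, forall i, [disjoint W i & A]} -> N (Z A t F) <= cost A t F.
Proof.
move=> h; rewrite /Z Zpin_free// /cost; have -> : untouched A F = F.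
  by apply/setP => i; rewrite inE; case: (boolP (i \in F)) => //= /h.
rewrite ler_peMl//; apply: (@le_trans _ _ (\prod_(i in F) 1)); first by rewrite big1_eq.
by apply: ler_prod => i _; rewrite ler01 lerDl charge_ge0.
Qed.

(** Remove [i] with [Zpin_clause]: the violating term has weight [P] and, by [cost_pin], at most 4
    times the cost without [i]. The resulting factor [1 + 4 * P] is [1 + charge A t i], as the
    truncation is inactive. *)
Lemma pin_bound_long n A t i F : small_ratio n -> pin_bound n ->
  i \notin F -> (#|F| < n)%N -> ~~ [disjoint W i & A] -> agr A t i ->
  4 * \prod_(v in W i :\: A) N (b v (phi i v)) <= eta ->
  N (Z A t (i |: F)) <= cost A t (i |: F).
Proof.
move=> An Bn iF cF dA ag; set P := \prod_(v in _) _ => le_eta.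
rewrite cost_touched// {1}/charge ag (negPf dA)/= (min_idPr le_eta).
rewrite /Z Zpin_clause//; apply: (le_trans (ND _ _)); rewrite NN NM N_prod -/P mulrDl mul1r.
apply: lerD; first exact: Bn.
have P0 : 0 <= P by exact: prodr_ge0.
rewrite [4 * P]mulrC -mulrA ler_wpM2l//.
apply: (le_trans (Bn _ _ _ cF)); apply: (cost_pin _ _ An).
by apply: leq_trans (ltnW cF); apply: subset_leq_card; exact: untouched_sub.
Qed.

(** Average over the two values of [v]. Charges of clauses avoiding [v] do not move, and
    [reveal_gain] controls the others because [i] is saturated. *)
Lemma pin_bound_short n A t i F v : small_ratio n ->
  (forall t', N (Z (v |: A) t' (i |: F)) <= cost (v |: A) t' (i |: F)) ->
  i \notin F -> (#|F| < n)%N -> v \in W i -> v \notin A ->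
  ~~ [disjoint W i & A] -> charge A t i = eta ->
  N (Z A t (i |: F)) <= cost A t (i |: F).
Proof.
move=> An IH iF cF vW vA dA ch; set G := i |: F.
have e1 : 0 < (1 - eps) ^+ D by rewrite exprn_gt0//; have := eps_lt1; lra.
(* This factor pays for the at most [D] clauses through [v] that stop being untouched. *)
rewrite -(ler_pM2r e1).
set pt := fun y : bool => patch t [set v]%SET (fun=> y).
pose T := [set j in G | v \in W j]%SET; pose T' := [set j in G | v \notin W j]%SET.
have split_prod (g : I -> R) : \prod_(j in G) g j = \prod_(j in T) g j * \prod_(j in T') g j.
  by rewrite (bigID (fun j => v \in W j))/=; congr (_ * _); apply: eq_bigl => j; rewrite !inE.
pose Q := \prod_(j in T') (1 + charge A t j).
have Q0 : 0 <= Q by apply: prodr_ge0 => j _; rewrite addr_ge0 ?charge_ge0.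
have eQ y : \prod_(j in T') (1 + charge (v |: A) (pt y) j) = Q.
  apply: eq_bigr => j; rewrite inE => /andP[_ vWj].
  by rewrite finset.setUC charge_patch// disjoint_sym disjoints1.
set X := N (Z0 (untouched (v |: A) G)).
have hX : X * (1 - eps) ^+ D <= N (Z0 (untouched A G)).
  have cU : (#|untouched A G| <= n)%N.
    apply: leq_trans (ltnW cF); apply: subset_leq_card; apply/fintype.subsetP => j.
    rewrite !inE; case: (eqVneq j i) => [->|_ /andP[]//].
    by rewrite (negPf dA) andbF.
  by have := small_ratio_untouched [set v]%SET An cU; rewrite cards1 mul1n finset.setUC.
have h y : N (Z (v |: A) (pt y) G) <=
    \prod_(j in T) (1 + charge (v |: A) (pt y) j) * Q * X.
  by apply: (le_trans (IH _)); rewrite /cost split_prod eQ.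
have gain : N (b v true) * \prod_(j in T) (1 + charge (v |: A) (pt true) j)
  + N (b v false) * \prod_(j in T) (1 + charge (v |: A) (pt false) j)
  <= (1 - eps) ^+ D * \prod_(j in T) (1 + charge A t j).
  apply: (@reveal_gain A t T i v true) => //; last by rewrite !inE eqxx.
  by apply/fintype.subsetP => j; rewrite !inE => /andP[].
have step : N (Z A t G) <= (N (b v true) * \prod_(j in T) (1 + charge (v |: A) (pt true) j)
  + N (b v false) * \prod_(j in T) (1 + charge (v |: A) (pt false) j)) * (Q * X).
  rewrite /Z (Zpin_reveal W phi b t _ true vA); apply: (le_trans (ND _ _)); rewrite !NM mulrDl.
  by apply: lerD; rewrite -mulrA ler_wpM2l// mulrA; exact: h.
have QX : 0 <= Q * X by rewrite mulr_ge0 ?N_ge0.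
apply: (le_trans (ler_wpM2r (ltW e1) (le_trans step (ler_wpM2r QX gain)))).
rewrite /cost split_prod -/Q [leRHS]mulrC -!mulrA ler_wpM2l ?(ltW e1)//.
rewrite ler_wpM2l//; first by apply: prodr_ge0 => j _; rewrite addr_ge0 ?charge_ge0.
by rewrite ler_wpM2l.
Qed.

(** Inner induction on the number of unpinned variables. A touched clause is already satisfied, or
    light enough to remove, or fully violated so that the mass is 0, or has a free variable to
    reveal; only the last case keeps all clauses. *)
Lemma pin_boundS n : small_ratio n -> pin_bound n -> pin_bound n.+1.
Proof.
move=> An Bn A t F; rewrite ltnS => cF.
have [m] := ubnP #|~: A|; elim: m A t => // m IH A t cA.
case: (boolP [forall i in F, [disjoint W i & A]]) => [/forall_inP|].
  exact: pin_bound_untouched.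
rewrite negb_forall_in => /exists_inP[i iF dA].
have iG : i \notin F :\ i by rewrite !inE eqxx.
have cG : (#|F :\ i| < n)%N by move: cF; rewrite (cardsD1 i) iF.
case: (boolP (agr A t i)) => [ag|nag]; last first.
  rewrite -(finset.setD1K iF) cost_touched// {1}/charge nag orbT addr0 mul1r /Z Zpin_sat//.
  exact: Bn.
have [le_eta|/ltW le_eta] := lerP (4 * \prod_(v in W i :\: A) N (b v (phi i v))) eta.
  by rewrite -(finset.setD1K iF); apply: (pin_bound_long An Bn).
have [sW|] := boolP (W i \subset A).
  by rewrite /Z (Zpin_violated _ iF sW ag) N0 cost_ge0.
case/fintype.subsetPn => v vW vA.
have cv : (#|~: (v |: A)| < m)%N.
  apply: (@leq_trans #|~: A|) => //; apply: proper_card; apply/properP; split.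
    by rewrite finset.setCS; apply/fintype.subsetP => u uA; rewrite !inE uA orbT.
  by exists v; rewrite !inE ?eqxx.
have ch : charge A t i = eta by rewrite /charge ag (negPf dA)/=; exact/min_idPl.
rewrite -(finset.setD1K iF); apply: (@pin_bound_short n A t i (F :\ i) v) => //.
by move=> t'; rewrite finset.setD1K//; exact: IH.
Qed.

(** With nothing pinned the cost is [N (Z0 F)]; pinning [W i] multiplies it by at most 4, and the
    violating weight is at most [r ^+ k]. This is where [eps] gets its value. *)
Lemma small_ratioS n : small_ratio n -> pin_bound n.+1 -> small_ratio n.+1.
Proof.
move=> An Bn i F iF cF; rewrite {1}/Z0 /Zfree Zpin_clause; last first.
  by apply/agreeP => v; rewrite !inE andbF.
rewrite addrAC subrr add0r NN NM N_prod finset.setD0.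
have cost0 : cost finset.set0 xpred0 F = N (Z0 F).
  rewrite /cost (_ : untouched _ _ = F); last first.
    by apply/setP => j; rewrite inE -setI_eq0 finset.setI0 eqxx andbT.
  by rewrite big1 ?mul1r// => j _; rewrite /charge -setI_eq0 finset.setI0 eqxx addr0.
have cU : (#|untouched finset.set0 F| <= n)%N.
  by apply: (@leq_trans #|F|) => //; apply: subset_leq_card; exact: untouched_sub.
have h := le_trans (Bn _ _ _ cF) (cost_pin xpred0 i An cU).
apply: (le_trans (ler_wpM2l (prod_N_ge0 _ _) h)); rewrite cost0 mulrCA mulrA.
by rewrite ler_wpM2r// ler_wpM2l// -(W_card i) prod_N_le.
Qed.

(** Starting from the value 1 without clauses, each added clause keeps a fraction [1 - eps > 0] of
    the norm. *)
Lemma Zfree_neq0 F : Zfree W phi b F != 0.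
Proof.
have ind n : small_ratio n /\ pin_bound n.
  elim: n => [|n [An Bn]]; first by split=> ?.
  have Bn1 := pin_boundS An Bn; split=> //; exact: small_ratioS.
have [An _] := ind #|F|.
have := small_ratio_sub An (finset.sub0set F) (leqnn _) (max_card _).
rewrite /Z0 Zfree0// N1 mul1r => h; apply/eqP => F0; move: h; rewrite F0 N0.
by apply/negP; rewrite -ltNge exprn_gt0// subr_gt0.
Qed.

End LocalLemma.

(** * From CNF formulas to normalised weights *)

Section CNFEncoding.

Context (V : finType) (Phi : cnf V).

(** Clauses are indexed by position, so repeated ones stay distinct and degrees agree with
    [count]. *)
Let cl (i : 'I_(size Phi)) : clause V := tnth (in_tuple Phi) i.

Definition violator (i : 'I_(size Phi)) (v : V) : bool := (v, false) \in cl i.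

(** A clause containing both literals of a variable always holds and has no violating assignment, so
    it must be left out. *)
Definition non_tautological : {set 'I_(size Phi)} :=
  [set i | [forall v, ((v, true) \notin cl i) || ((v, false) \notin cl i)]]%SET.

Let scope (i : 'I_(size Phi)) := clause_vars (cl i).

Lemma clause_satE (s : {ffun V -> bool}) i :
  clause_sat s (cl i) =
  (i \in non_tautological) ==> ~~ agree (scope i) (violator i) s.
Proof.
rewrite inE; apply/exists_inP/implyP.
  case=> -[v x] /= vx /eqP sx /forallP /(_ v) nt; apply/negP => /agreeP /(_ v).
  have vW : v \in scope i by apply/imsetP; exists (v, x).
  move=> /(_ vW); rewrite sx /violator; case: x vx {sx} => vx; last by rewrite vx.
  by move: nt; rewrite vx /= => /negPf->.
case: (boolP [forall v, _]) => [/forallP nt /(_ isT)|].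
  rewrite negb_forall_in => /exists_inP[v /imsetP[[u x] /= ux ->]].
  rewrite /violator => ne; exists (u, x) => //=; move: (nt u) ne.
  case: x ux => -> /=; last by case: (s u).
  by move=> /negPf->; case: (s u).
rewrite negb_forall => /existsP[v]; rewrite negb_or !negbK => /andP[vt vf] _.
by exists (v, s v) => //=; case: (s v).
Qed.

(** Each variable contributes the sum of its two weights as a factor: [1 + lambda] inside [M], and 2
    outside, where both weights are 1. *)
Lemma Z_CNF_Zfree (A : fieldType) (M : {set V}) (lambda : A) :
  1 + lambda != 0 -> 2 != 0 :> A ->
  Z_CNF Phi M lambda = (\prod_v (if v \in M then 1 + lambda else 2)) *
    Zfree scope violator
      (fun v x => if v \in M then (if x then lambda else 1) / (1 + lambda) else 2^-1)
      non_tautological.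
Proof.
move=> l0 two0; rewrite mulr_sumr; apply: eq_big => [s|s _].
  rewrite inE -[Phi]/(tval (in_tuple Phi)); apply/all_tnthP/andP => [h|[_ /forall_inP h] i].
    split; first by apply/agreeP => v; rewrite inE.
    apply/forall_inP => i iF; have := h i; rewrite -[tnth _ i]/(cl i) clause_satE.
    by move/implyP; exact.
  by rewrite -[tnth _ i]/(cl i) clause_satE; apply/implyP; exact: h.
rewrite [X in _ = _ * X](eq_bigl predT) => [|v]; last by rewrite !inE.
rewrite -big_split/= -prodr_const [LHS]big_mkcond/=.
apply: eq_bigr => v _; rewrite !inE; case: (v \in M) => /=; last by rewrite divff.
by rewrite mulrC divfK//; case: (s v).
Qed.

End CNFEncoding.

(** * Numerical conditions of the local lemma *)

Section LocalLemmaNumerics.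

Context (R : realType).

Lemma inv_le_of_ge (x m : R) : 0 < m -> m <= x -> 0 < x^-1 <= m^-1.
Proof. by move=> m0 mx; rewrite invr_gt0 lef_pV2 ?posrE ?(lt_le_trans m0 mx)// mx. Qed.

(** The product of [(1 + x) ^+ n] and [(1 - x) ^+ n] is at most 1, and Bernoulli bounds the second
    factor below by 1/2. *)
Lemma exprD1_le2 (x : R) n : 0 <= x -> n%:R * x <= 1 / 2 -> (1 + x) ^+ n <= 2.
Proof.
move=> x0; have [->|n0] := eqVneq n 0%N; first by rewrite expr0; lra.
have n1 : 1 <= n%:R :> R by rewrite ler1n lt0n.
move=> nx; have x1 : x <= 1 / 2 by apply: le_trans nx; rewrite ler_peMl.
have h1 : 1 / 2 <= (1 - x) ^+ n by have := @bernoulli_le R x n; lra.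
have h2 : (1 + x) ^+ n * (1 - x) ^+ n <= 1.
  by rewrite -exprMn exprn_ile1//; nra.
have h3 : 0 <= (1 + x) ^+ n by apply: exprn_ge0; lra.
nra.
Qed.

Context (k D : nat) (r : R).
Hypotheses (D2 : (2 <= D)%N) (k57 : (57 <= k)%N).
Hypotheses (r0 : 0 <= r) (rk : r ^+ k <= (256 * D%:R ^+ 4 * k%:R ^+ 8)^-1).

(** In terms of [w] and [e] every quantity becomes a monomial in two small numbers, which linear
    arithmetic can compare. *)
Let w : R := k%:R^-1.
Let e : R := D%:R^-1.
Let eta : R := (16 * D%:R ^+ 2 * k%:R ^+ 2)^-1.

Let kw : k%:R * w = 1.
Proof. by rewrite divff// pnatr_eq0 -lt0n (leq_trans _ k57). Qed.

Let De : D%:R * e = 1.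
Proof. by rewrite divff// pnatr_eq0 -lt0n (leq_trans _ D2). Qed.

Let w_bnd : 0 < w <= 57^-1.
Proof. by apply: inv_le_of_ge; rewrite ?ltr0n// ler_nat. Qed.

Let e_bnd : 0 < e <= 2^-1.
Proof. by apply: inv_le_of_ge; rewrite ?ltr0n// ler_nat. Qed.

Let etaE : eta = e ^+ 2 * w ^+ 2 / 16.
Proof. by rewrite /eta /e /w 2!invfM !exprVn -mulrA mulrC. Qed.

Let gammaE : gamma_CNF R k D = e ^+ 2 * w ^+ 5 / 2000.
Proof. by rewrite /gamma_CNF /e /w 2!invfM !exprVn -mulrA mulrC. Qed.

Let rk_le : r ^+ k <= e ^+ 4 * w ^+ 8 / 256.
Proof. by move: rk; rewrite /e /w 2!invfM !exprVn -mulrA mulrC. Qed.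

Let pow_bnd i j : 0 <= e ^+ i * w ^+ j <= 1.
Proof.
have /andP[w0 w1] := w_bnd; have /andP[e0 e1] := e_bnd.
have ei : 0 <= e ^+ i <= 1 by rewrite exprn_ge0 ?exprn_ile1 ?(ltW e0)//; lra.
have wj : 0 <= w ^+ j <= 1 by rewrite exprn_ge0 ?exprn_ile1 ?(ltW w0)//; lra.
by move/andP: ei => [? ?]; move/andP: wj => [? ?]; rewrite mulr_ge0// mulr_ile1.
Qed.

Lemma gamma_bnd : 0 < gamma_CNF R k D <= 1000^-1.
Proof.
have /andP[w0 w1] := w_bnd; have /andP[e0 e1] := e_bnd.
have /andP[_ h] := pow_bnd 2 5; rewrite gammaE; apply/andP; split; last lra.
by rewrite divr_gt0 ?ltr0n ?mulr_gt0 ?exprn_gt0.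
Qed.

Lemma k_gamma_le : k%:R * (4 * gamma_CNF R k D) <= 1 / 2.
Proof.
have /andP[_ h] := pow_bnd 2 4; rewrite gammaE.
have -> : k%:R * (4 * (e ^+ 2 * w ^+ 5 / 2000)) = (k%:R * w) * (e ^+ 2 * w ^+ 4) / 500 by field.
by rewrite kw; lra.
Qed.

(** Otherwise Bernoulli would give [r ^+ k] at least 1/2. This gap below 1 drives the drift in
    [reveal_cost_le]. *)
Let r_lt : r <= 1 - w / 2.
Proof.
have /andP[w0 w1] := w_bnd; have /andP[_ h] := pow_bnd 4 8.
rewrite leNgt; apply/negP => /ltW hr.
have : (1 - w / 2) ^+ k <= r ^+ k by rewrite lerXn2r// ?nnegrE//; lra.
have : 1 - k%:R * (w / 2) <= (1 - w / 2) ^+ k by apply: bernoulli_le; lra.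
rewrite mulrA kw; have := rk_le; lra.
Qed.

Lemma ratio_le1 : r <= 1.
Proof. by apply: (le_trans r_lt); have /andP[w0 _] := w_bnd; lra. Qed.

Lemma clause_weight_lt1 : 4 * r ^+ k < 1.
Proof. by have /andP[_ h] := pow_bnd 4 8; have := rk_le; lra. Qed.

Lemma D_eta_le1 : D%:R * eta <= 1.
Proof.
have /andP[_ h] := pow_bnd 1 2; rewrite etaE.
have -> : D%:R * (e ^+ 2 * w ^+ 2 / 16) = (D%:R * e) * (e ^+ 1 * w ^+ 2) / 16 by field.
by rewrite De; lra.
Qed.

(** The left side is at most 2 and the power on the right at least 1/2. *)
Lemma touch_cost_le : (1 + eta) ^+ (k * D) <= 4 * (1 - 4 * r ^+ k) ^+ (k * D).
Proof.
have kD0 : 0 <= k%:R * D%:R :> R by rewrite mulr_ge0.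
have h1 : (1 + eta) ^+ (k * D) <= 2.
  apply: exprD1_le2; first by rewrite etaE divr_ge0//; have /andP[] := pow_bnd 2 2.
  have /andP[_ h] := pow_bnd 1 1; rewrite natrM etaE.
  have -> : k%:R * D%:R * (e ^+ 2 * w ^+ 2 / 16) =
    (k%:R * w) * (D%:R * e) * (e ^+ 1 * w ^+ 1) / 16 by field.
  by rewrite kw De; lra.
have h2 : (k * D)%:R * (4 * r ^+ k) <= 1 / 2.
  apply: (@le_trans _ _ ((k * D)%:R * (e ^+ 4 * w ^+ 8 / 64))).
    by rewrite ler_wpM2l//; have := rk_le; lra.
  have /andP[_ h] := pow_bnd 3 7; rewrite natrM.
  have -> : k%:R * D%:R * (e ^+ 4 * w ^+ 8 / 64) =
    (k%:R * w) * (D%:R * e) * (e ^+ 3 * w ^+ 7) / 64 by field.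
  by rewrite kw De; lra.
have := @bernoulli_le R (4 * r ^+ k) (k * D) (ltW clause_weight_lt1); lra.
Qed.

Lemma reveal_cost_le (kappa := 1 + 4 * gamma_CNF R k D) :
  kappa - 1 + 3 * (D%:R * (4 * r ^+ k)) + kappa * (D%:R * eta) ^+ 2 <= (1 - r) * eta.
Proof.
have /andP[w0 w1] := w_bnd; have /andP[e0 e1] := e_bnd.
have eta0 : 0 <= eta by rewrite etaE divr_ge0//; have /andP[] := pow_bnd 2 2.
have kappa2 : kappa <= 2 by rewrite /kappa; have /andP[] := gamma_bnd; lra.
have h1 : 3 * (D%:R * (4 * r ^+ k)) <= 3 * (e ^+ 3 * w ^+ 8 / 64).
  rewrite ler_wpM2l//; apply: (@le_trans _ _ (D%:R * (e ^+ 4 * w ^+ 8 / 64))).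
    by rewrite ler_wpM2l//; have := rk_le; lra.
  have -> : D%:R * (e ^+ 4 * w ^+ 8 / 64) = (D%:R * e) * (e ^+ 3 * w ^+ 8) / 64 by field.
  by rewrite De mul1r.
have h2 : kappa * (D%:R * eta) ^+ 2 <= 2 * (e ^+ 2 * w ^+ 4 / 256).
  have -> : D%:R * eta = (D%:R * e) * (e * w ^+ 2) / 16 by rewrite etaE; field.
  rewrite De mul1r; apply: (@le_trans _ _ (2 * (e * w ^+ 2 / 16) ^+ 2)).
    by rewrite ler_wpM2r// sqr_ge0.
  by rewrite le_eqVlt; apply/orP; left; apply/eqP; field.
have h3 : w / 2 * eta <= (1 - r) * eta by rewrite ler_wpM2r//; have := r_lt; lra.
have h4 : kappa - 1 = e ^+ 2 * w ^+ 5 / 500 by rewrite /kappa gammaE; field.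
(* The required inequality divided by [e ^+ 2 * w ^+ 3], the order of the drift; each loss keeps a
   spare factor [w]. *)
have h5 : w ^+ 2 / 500 + 3 * (e * w ^+ 5 / 64) + w / 128 <= 1 / 32.
  have /andP[_] := pow_bnd 0 1; have /andP[_] := pow_bnd 1 4.
  rewrite expr0 !expr1 mul1r => i1 i2.
  have : w ^+ 2 <= w * 1 by rewrite expr2 ler_wpM2l// ltW.
  have : e * w ^+ 5 <= w * 1.
    by rewrite (_ : e * w ^+ 5 = w * (e * w ^+ 4)); [rewrite ler_wpM2l// ltW | ring].
  lra.
have h6 : 0 <= e ^+ 2 * w ^+ 3 by have /andP[] := pow_bnd 2 3.
have h7 := ler_wpM2l h6 h5.
rewrite h4; apply: le_trans h3.
have -> : w / 2 * eta = e ^+ 2 * w ^+ 3 * (1 / 32) by rewrite etaE; field.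
apply: le_trans h7.
rewrite (_ : e ^+ 2 * w ^+ 3 * _ = e ^+ 2 * w ^+ 5 / 500 + 3 * (e ^+ 3 * w ^+ 8 / 64) +
  2 * (e ^+ 2 * w ^+ 4 / 256)); last by field.
apply: lerD; last exact: h2.
rewrite lerD2l; exact: h1.
Qed.

End LocalLemmaNumerics.

(** * Zero-freeness for a complex fugacity *)

Section ComplexFugacity.

Context (R : realType).

(** The local lemma needs a norm with values in [R], whereas the generic norm on [R[i]] has values
    in [R[i]]. *)
Let N : R[i] -> R := @Normc.normc R.

Lemma normcE (z : R[i]) : `|z| = (Normc.normc z)%:C.
Proof. by rewrite normc_def; case: z. Qed.

Let N_ge0 z : 0 <= N z.
Proof. by rewrite -lecR -normcE normr_ge0. Qed.

Let N_real (x : R) : 0 <= x -> N x%:C = x.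
Proof. by move=> x0; apply: complexI; rewrite -normcE ger0_norm// lecR. Qed.

Let N0 : N 0 = 0.
Proof. exact: Normc.normc0. Qed.

Let N1 : N 1 = 1.
Proof. exact: Normc.normc1. Qed.

Let NM x y : N (x * y) = N x * N y.
Proof. exact: Normc.normcM. Qed.

Let NV x : N x^-1 = (N x)^-1.
Proof. exact: Normc.normcV. Qed.

Let NN x : N (- x) = N x.
Proof. by apply: complexI; rewrite -!normcE normrN. Qed.

Let ND x y : N (x + y) <= N x + N y.
Proof. by rewrite -lecR rmorphD/= -!normcE ler_normD. Qed.

Lemma Z_CNF_neq0_ratio (V : finType) (Phi : cnf V) (k D : nat) (M : {set V})
    (r : R) (lambda : R[i]) :
  (2 <= D)%N -> (57 <= k)%N -> is_kD_cnf k D Phi ->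
  0 < N (1 + lambda) -> 1 <= r * N (1 + lambda) -> N lambda <= r * N (1 + lambda) ->
  1 + N lambda <= (1 + 4 * gamma_CNF R k D) * N (1 + lambda) ->
  r ^+ k <= (256 * D%:R ^+ 4 * k%:R ^+ 8)^-1 ->
  Z_CNF Phi M lambda != 0.
Proof.
move=> D2 k57 [kPhi DPhi] m0 r1 rl kap rk.
have N2 : N 2 = 2 by rewrite -[2 in LHS]/(2%:R) -(rmorph_nat (real_complex R)) N_real.
(* Variables outside [M] have weights 1/2, which [r] must dominate too; the triangle inequality
   ensures it. *)
have r12 : 1 / 2 <= r.
  have h : N (1 + lambda) <= 1 + N lambda by rewrite -[in leRHS]N1; exact: ND.
  have : 1 * N (1 + lambda) <= 2 * r * N (1 + lambda) by lra.
  by rewrite ler_pM2r//; lra.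
have l0 : 1 + lambda != 0 by apply: contraTneq m0 => ->; rewrite N0 ltxx.
have two0 : 2 != 0 :> R[i] by rewrite pnatr_eq0.
rewrite Z_CNF_Zfree// mulf_neq0//.
  by apply/prodf_neq0 => v _; case: ifP.
have r0 : 0 <= r by lra.
have g1 := gamma_bnd R D2 k57.
apply: (@Zfree_neq0 R R[i] N N_ge0 N0 N1 NM NN ND V _ _ _ _ _ k D r
  (1 + 4 * gamma_CNF R k D) (16 * D%:R ^+ 2 * k%:R ^+ 2)^-1).
- move=> v; case: ifP => _; last by rewrite -[2^-1]mul1r; field.
  by rewrite -mulrDl divff.
- move=> v x; case: ifP => _; last by rewrite NV N2; lra.
  rewrite NM NV ler_pdivrMr//; case: x => //.
  by rewrite N1.
- move=> v; case: ifP => _; last by rewrite NV N2; have /andP[] := g1; lra.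
  rewrite !NM NV -mulrDl ler_pdivrMr//.
  by rewrite N1.
- by move=> i; apply: kPhi; exact: mem_tnth.
- move=> v; apply: leq_trans (DPhi v).
  by rewrite -sum1_count big_tnth sum1_card cardsE.
- exact: r0.
- exact: ratio_le1 D2 k57 r0 rk.
- exact: clause_weight_lt1 D2 k57 rk.
- by rewrite invr_ge0 ?mulr_ge0 ?exprn_ge0.
- exact: D_eta_le1.
- exact: touch_cost_le.
- exact: reveal_cost_le.
Qed.

Lemma Z_CNF_neq0_near (V : finType) (Phi : cnf V) (k D : nat) (M : {set V})
    (r lambda_c : R) (lambda : R[i]) (g := gamma_CNF R k D) :
  (2 <= D)%N -> (57 <= k)%N -> is_kD_cnf k D Phi -> 0 <= lambda_c ->
  `|lambda - lambda_c%:C| <= g%:C ->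
  Num.max 1 (lambda_c + g) <= r * (1 + lambda_c - g) ->
  0 <= r -> r ^+ k <= (256 * D%:R ^+ 4 * k%:R ^+ 8)^-1 ->
  Z_CNF Phi M lambda != 0.
Proof.
move=> D2 k57 kPhi lc0; rewrite normcE lecR -/(N _) ge_max => near /andP[r1 rl] r0 rk.
have /andP[g0 g1] := gamma_bnd R D2 k57; rewrite -/g in g0 g1.
have up : N lambda <= lambda_c + g.
  have := ND lambda_c%:C (lambda - lambda_c%:C).
  by rewrite addrC subrK N_real//; lra.
have low : 1 + lambda_c - g <= N (1 + lambda).
  have := ND (1 + lambda) (- (lambda - lambda_c%:C)); rewrite NN.
  have -> : 1 + lambda - (lambda - lambda_c%:C) = (1 + lambda_c)%:C.
    by rewrite rmorphD rmorph1/=; ring.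
  by rewrite N_real ?addr_ge0//; lra.
have h : r * (1 + lambda_c - g) <= r * N (1 + lambda) by rewrite ler_wpM2l.
apply: (@Z_CNF_neq0_ratio V Phi k D M r lambda) => //.
- by lra.
- by lra.
- by lra.
(* It suffices that [1 + lambda_c + g] is at most [(1 + 4 * g) * (1 + lambda_c - g)], which holds as
   [g] is small. *)
- rewrite -/g; nra.
Qed.

End ComplexFugacity.

(** * Consequences of the logarithmic lower bound on the clause size *)

Section LogHypothesis.

Context (R : realType) (k D : nat).
Hypothesis D2 : (2 <= D)%N.
Hypothesis hk : 12 * log2 (D%:R : R) + 24 * log2 (k%:R : R) + 57 <= k%:R.

Let ln2_gt0 : 0 < ln 2 :> R.
Proof. by rewrite ln_gt0// ltr1n. Qed.

Let D0 : (0 < D)%N.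
Proof. exact: leq_trans D2. Qed.

Lemma log_hyp_k_ge57 : (57 <= k)%N.
Proof.
have log_ge0 n : 0 <= log2 (n%:R : R).
  (* At this point [k] could still be 0; the convention [ln 0 = 0] covers that case. *)
  rewrite divr_ge0 ?(ltW ln2_gt0)//; case: n => [|n]; first by rewrite ln0.
  by rewrite ln_ge0// ler1n.
have := log_ge0 D; have := log_ge0 k; rewrite -(ler_nat R); move: hk; lra.
Qed.

Let k0 : (0 < k)%N.
Proof. exact: leq_trans log_hyp_k_ge57. Qed.

Lemma log_hyp_expn : 2 ^+ 57 * D%:R ^+ 12 * k%:R ^+ 24 <= 2 ^+ k :> R.
Proof.
have kR : 0 < k%:R :> R by rewrite ltr0n.
have DR : 0 < D%:R :> R by rewrite ltr0n.
have pX n : 0 < 2 ^+ n :> R by rewrite exprn_gt0.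
have pD : 0 < D%:R ^+ 12 :> R by rewrite exprn_gt0.
have pk : 0 < k%:R ^+ 24 :> R by rewrite exprn_gt0.
rewrite -ler_ln ?posrE ?mulr_gt0//.
rewrite lnM ?posrE ?mulr_gt0// lnM ?posrE// !lnXn//.
have := ler_wpM2r (ltW ln2_gt0) hk; rewrite /log2 !mulrDl -!mulrA mulVf ?gt_eqF// !mulr1.
rewrite -(mulr_natl (ln 2) k); lra.
Qed.

(** The base is the ratio used around fugacity 1. Its correction contributes at most a factor 2, and
    [2 ^+ k] is large by [log_hyp_expn]. *)
Lemma half_expn_le : (1 / 2 * (1 + 4 * gamma_CNF R k D)) ^+ k <=
  (256 * D%:R ^+ 4 * k%:R ^+ 8)^-1.
Proof.
have k57 := log_hyp_k_ge57.
have /andP[g0 _] := gamma_bnd R D2 k57.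
have h2 : (1 + 4 * gamma_CNF R k D) ^+ k <= 2.
  by apply: exprD1_le2; [lra | exact: k_gamma_le].
have kR : 1 <= k%:R :> R by rewrite ler1n.
have DR : 1 <= D%:R :> R by rewrite ler1n.
have pX n : 0 < 2 ^+ n :> R by rewrite exprn_gt0.
have pos : 0 < 256 * D%:R ^+ 4 * k%:R ^+ 8 :> R.
  by rewrite !mulr_gt0 ?exprn_gt0 ?ltr0n.
rewrite exprMn div1r exprVn; apply: (@le_trans _ _ ((2 ^+ k)^-1 * 2)).
  by rewrite ler_wpM2l// invr_ge0 ltW.
rewrite ler_pdivrMl// ler_pdivlMr//; apply: le_trans log_hyp_expn.
have -> : 2 * (256 * D%:R ^+ 4 * k%:R ^+ 8) = 2 ^+ 9 * D%:R ^+ 4 * k%:R ^+ 8 :> R by ring.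
apply: ler_pM; rewrite ?mulr_ge0 ?exprn_ge0 ?ler_weXn2l//.
by apply: ler_pM; rewrite ?exprn_ge0 ?ler_weXn2l ?ler1n.
Qed.

End LogHypothesis.

(** * Choice of the set and conclusion *)

Lemma exists_set_card (V : finType) (m : nat) : (m <= #|V|)%N -> exists M : {set V}, #|M| = m.
Proof.
move=> mV; exists [set v in take m (enum V)]%SET.
rewrite cardsE (card_uniqP (take_uniq _ (enum_uniq V))) size_takel//.
by rewrite -cardE.
Qed.

Lemma half_card_bounds (R : realFieldType) (n : nat) : n != 1%N ->
  n%:R / 6 <= (n./2)%:R :> R /\ (n./2)%:R <= 4 * n%:R / 5 :> R.
Proof.
move=> n1; have e1 : (n <= 6 * n./2)%N by lia.
have e2 : (5 * n./2 <= 4 * n)%N by lia.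
move: e1 e2; rewrite -!(ler_nat R) !natrM => e1 e2; split; lra.
Qed.

(** Squaring the hypothesis, with [expR 1 ^+ 3] bounded below by 1, gives exactly the target bound
    for the exponent [34 / 100 * k%:R]; as [r <= 1], raising the exponent to [k] only helps. *)
Lemma fugacity_ratio_expn (R : realType) (k D : nat) (r : R) :
  (2 <= D)%N -> (57 <= k)%N -> 0 < r ->
  r `^ (17 / 100 * k%:R) <= (16 * expR 1 ^+ 3 * D%:R ^+ 2 * k%:R ^+ 4)^-1 ->
  r ^+ k <= (256 * D%:R ^+ 4 * k%:R ^+ 8)^-1.
Proof.
move=> D2 k57 r0; set Y := (16 * _ * _ * _)^-1 => hr.
have kR : 1 <= k%:R :> R by rewrite ler1n (leq_trans _ k57).
have DR : 1 <= D%:R :> R by rewrite ler1n (leq_trans _ D2).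
have e1 : 1 <= expR 1 :> R by have := @expR_ge1Dx R 1; lra.
have base : 16 * D%:R ^+ 2 * k%:R ^+ 4 <= 16 * expR 1 ^+ 3 * D%:R ^+ 2 * k%:R ^+ 4 :> R.
  do 2 (apply: ler_wpM2r; first exact: exprn_ge0).
  by rewrite ler_peMr ?exprn_ege1.
have pos : 1 < 16 * D%:R ^+ 2 * k%:R ^+ 4 :> R.
  apply: (@lt_le_trans _ _ (16 * 1 * 1)); first lra.
  by apply: ler_pM; rewrite ?exprn_ege1// ler_pM// exprn_ege1.
have Yle : Y <= (16 * D%:R ^+ 2 * k%:R ^+ 4)^-1 by rewrite lef_pV2 ?posrE//; lra.
have r1 : r <= 1.
  rewrite leNgt; apply/negP => r1.
  have : 1 <= r `^ (17 / 100 * k%:R).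
    by rewrite -[leLHS](powRr0 r); apply: ler_powR; [exact: ltW | lra].
  have : (16 * D%:R ^+ 2 * k%:R ^+ 4)^-1 < 1 :> R by rewrite invf_lt1//; lra.
  lra.
rewrite -powR_mulrn ?(ltW r0)//.
apply: (@le_trans _ _ (r `^ (17 / 100 * k%:R * 2))).
  by apply: ger_powR; [rewrite r0 r1 | lra].
rewrite powRrM -[2]/(2%:R) powR_mulrn ?powR_ge0//.
apply: (@le_trans _ _ ((16 * D%:R ^+ 2 * k%:R ^+ 4)^-1 ^+ 2)).
  by rewrite lerXn2r// ?nnegrE ?powR_ge0 ?invr_ge0 ?mulr_ge0 ?exprn_ge0// (le_trans hr).
rewrite exprVn le_eqVlt; apply/orP; left; apply/eqP; congr _^-1; ring.
Qed.

(* The hypothesis [#|V| != 1] is needed: for |V| = 1 (hence no clause) no M has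
   |V| / 6 <= |M| <= 4 |V| / 5. *)
Theorem theorem5p15 (R : realType) (k D : nat) (hD : (2 <= D)%N)
    (hk : 12 * log2 (D%:R : R) + 24 * log2 (k%:R : R) + 57 <= k%:R)
    (V : finType) (hV : #|V| != 1%N)
    (Phi : cnf V) (hPhi : is_kD_cnf k D Phi) :
  exists M : {set V},
    [/\ #|V|%:R / 6 <= (#|M|%:R : R) <= 4 * #|V|%:R / 5,
        forall lambda : R[i],
          `|lambda - 1| <= (gamma_CNF R k D)%:C -> Z_CNF Phi M lambda != 0
      & forall lambda_c : R, 0 <= lambda_c ->
          (Num.max 1 (lambda_c + gamma_CNF R k D)
             / (1 + lambda_c - gamma_CNF R k D)) `^ (17 / 100 * k%:R)
            <= (16 * expR 1 ^+ 3 * D%:R ^+ 2 * k%:R ^+ 4)^-1 ->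
          forall lambda : R[i],
            `|lambda - lambda_c%:C| <= (gamma_CNF R k D)%:C ->
            Z_CNF Phi M lambda != 0].
Proof.
have k57 := log_hyp_k_ge57 hk.
have /andP[g0 g1] := gamma_bnd R hD k57.
have half_le : (#|V|./2 <= #|V|)%N by lia.
have [M cM] := exists_set_card half_le.
have [cM1 cM2] := half_card_bounds R hV.
exists M; split; first by rewrite cM cM1 cM2.
  move=> lambda near.
  (* At the centre 1 the ratio is [(1 + g) / (2 - g)], with [g] the radius; [(1 + 4 * g) / 2] is a
     convenient upper bound. *)
  apply: (@Z_CNF_neq0_near R V Phi k D M (1 / 2 * (1 + 4 * gamma_CNF R k D)) 1) => //.
  - by rewrite ge_max; apply/andP; split; nra.
  - by lra.
  - exact: half_expn_le.
move=> lc lc0 hr lambda near.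
have den0 : 0 < 1 + lc - gamma_CNF R k D by lra.
apply: (@Z_CNF_neq0_near R V Phi k D M
  (Num.max 1 (lc + gamma_CNF R k D) / (1 + lc - gamma_CNF R k D)) lc) => //.
- by rewrite divfK ?gt_eqF.
- by rewrite divr_ge0 ?(ltW den0)// le_max ler01.
- by apply: fugacity_ratio_expn hr => //; rewrite divr_gt0// lt_max ltr01.
Qed.
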